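(* Let $M^*$ be the true MDP, let $\mathcal D$ be a random dataset collected in $M^*$, let $\delta_{\mathbb I}\in[0,1]$ and let $\hat M_{\mathbb I}$ be the interval MDP estimated from $\mathcal D$, with $\Pr(M^*\in\hat M_{\mathbb I})\ge 1-\delta_{\mathbb I}$. Then the robust optimal reach-avoid probabilities of $\hat M_{\mathbb I}$ are a lower bound on the optimal reach-avoid probabilities of $M^*$ with probability at least $1-\delta_{\mathbb I}$: $$\forall s\in S:\quad \Pr\big(\mathbb V^*_{\hat M_{\mathbb I}}(s)\le \mathbb V^*_{M^*}(s)\big)\ \ge\ 1-\delta_{\mathbb I}.$$
   Context: MDP: a tuple $M=(S,s_0,A,T,R,\gamma)$ with finite state set $S$, initial state $s_0\in S$, finite action set $A$, nonempty sets $A(s)\subseteq A$ of actions available at $s$, a transition function assigning to each $s\in S$, $a\in A(s)$ a probability distribution $T(\cdot\mid s,a)$ on $S$, bounded reward $R:S\times A\to\mathbb R$, and $\gamma\in[0,1)$. A (stochastic memoryless) policy is $\pi:S\to\Delta(A)$ choosing available actions; $\Pi$ is the set of policies. Interval MDP (IMDP): like an MDP, but the transition function $T_{\mathbb I}$ assigns to each $(s,a,s')$, $a\in A(s)$, either the value $0$ or an interval $[l,u]$ with $0<l<u\le 1$. An MDP $M$ with the same $S,s_0,A,A(\cdot),R,\gamma$ and transition function $T$ belongs to the IMDP $M_{\mathbb I}$, written $M\in M_{\mathbb I}$, if for all $s$, $a\in A(s)$, $s'$: $T(s'\mid s,a)\in T_{\mathbb I}(s'\mid s,a)$ when that is an interval,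 and $T(s'\mid s,a)=0$ when it is $0$. The IMDP $\hat M_{\mathbb I}$ is a function of the random dataset $\mathcal D$; all probabilities $\Pr$ are over $\mathcal D$. $\hat M_{\mathbb I}$ has the same $S,s_0,A,A(\cdot),R,\gamma$ as $M^*$ and is constructed so that $\Pr(M^*\in\hat M_{\mathbb I})\ge 1-\delta_{\mathbb I}$. Reach-avoid: fixed disjoint sets $S_T\subset S$ (target) and $S_U\subset S$ (unsafe). For an MDP $M$, $\pi\in\Pi$, $s\in S$, $\mathbb P_M^{\pi,\varphi}(s)$ is the probability, starting in $s$ and following $\pi$ in $M$, that a state of $S_T$ is reached without visiting $S_U$ before (so it is $1$ for $s\in S_T$ and $0$ for $s\in S_U$). Define $\mathbb V^*_M(s)=\max_{\pi\in\Pi}\mathbb P_M^{\pi,\varphi}(s)$ and $\mathbb V^*_{\hat M_{\mathbb I}}(s)=\max_{\pi\in\Pi}\min_{M\in\hat M_{\mathbb I}}\mathbb P_M^{\pi,\varphi}(s)$. *)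

(* Defs.v *)
From HB Require Import structures.
From mathcomp Require Import all_boot all_order all_algebra.
From mathcomp Require Import all_classical all_reals all_analysis.

Set Implicit Arguments.
Unset Strict Implicit.
Unset Printing Implicit Defensive.

Import Order.TTheory GRing.Theory Num.Theory.
Local Open Scope classical_set_scope.
Local Open Scope ring_scope.

(* The components (S, s_0, A, A(.), R, gamma) shared by an interval MDP and
   all the MDPs that belong to it. The reward is automatically bounded, its
   domain being finite. *)
Record mdp_frame (R : realType) := MdpFrame {
  state : finType;
  init : state;
  action : finType;
  avail : state -> {set action};
  avail_neq0 : forall s, exists a, a \in avail s;
  reward : state -> action -> R;
  discount : R;
  discount_itv : 0 <= discount < 1 }.

Arguments init {R} m.
Arguments avail {R} m s.

(* Here and in [imdp], the values at unavailable actions are junk: they are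
   unconstrained, and no definition below depends on them. *)
Record mdp (R : realType) (F : mdp_frame R) := Mdp {
  trans : state F -> action F -> state F -> R;
  trans_ge0 : forall s a, a \in avail F s -> forall s', 0 <= trans s a s';
  trans_sum1 : forall s a, a \in avail F s -> \sum_s' trans s a s' = 1 }.

Record policy (R : realType) (F : mdp_frame R) := Policy {
  pol : state F -> action F -> R;
  pol_ge0 : forall s a, 0 <= pol s a;
  pol_sum1 : forall s, \sum_a pol s a = 1;
  pol_avail : forall s a, a \notin avail F s -> pol s a = 0 }.

(* [itrans s a s'] is [None] for the value 0 and [Some (l, u)] for the
   interval [l, u]. *)
Record imdp (R : realType) (F : mdp_frame R) := Imdp {
  itrans : state F -> action F -> state F -> option (R * R);
  itrans_itv : forall s a, a \in avail F s -> forall s' l u,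
    itrans s a s' = Some (l, u) -> [/\ 0 < l, l < u & u <= 1] }.

Definition in_imdp (R : realType) (F : mdp_frame R) (M : mdp F) (I : imdp F) :=
  forall s a, a \in avail F s -> forall s',
    match itrans I s a s' return Prop with
    | None => trans M s a s' = 0
    | Some (l, u) => l <= trans M s a s' <= u
    end.

Definition chain (R : realType) (F : mdp_frame R) (M : mdp F) (pi : policy F)
    (s s' : state F) : R :=
  \sum_(a in avail F s) pol pi s a * trans M s a s'.

Section runs.
Variables (R : realType) (F : mdp_frame R).

Definition cyl (n : nat) (w : nat -> state F) : set (nat -> state F) :=
  [set x | forall i, (i <= n)%N -> x i = w i].

Definition cylinders : set (set (nat -> state F)) :=
  [set C | exists n w, C = cyl n w].

HB.instance Definition _ := isPointed.Build (state F) (init F).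

Definition run := g_sigma_algebraType cylinders.
HB.instance Definition _ := Measurable.on run.

End runs.
Arguments run {R} F.

(* Existence of the law of a finite-state Markov chain, by pushing forward the
   uniform law on [0, 1[ along iterated inverse-CDF sampling. *)
Section run_law.
Variables (R : realType) (F : mdp_frame R).
Local Notation S := (state F).
Variable p : S -> S -> R.
Hypothesis p_ge0 : forall s t, 0 <= p s t.
Hypothesis p_sum1 : forall s, \sum_t p s t = 1.

Let C (s : S) (i : nat) : R := \sum_(t | (enum_rank t < i)%N) p s t.
Let cum (s t : S) : R := C s (enum_rank t).

Let C_S s t : C s (enum_rank t).+1 = cum s t + p s t.
Proof.
rewrite /C (bigD1 t)//= addrC; congr (_ + _); apply: eq_bigl => t'.
rewrite ltnS ltn_neqAle andbC; congr (_ && _).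
by rewrite (inj_eq val_inj) (inj_eq enum_rank_inj).
Qed.

Let C_homo s i j : (i <= j)%N -> C s i <= C s j.
Proof.
move=> ij; rewrite /C [leLHS]big_mkcond [leRHS]big_mkcond/=.
apply: ler_sum => t _; case: ifPn => [ti|_]; last by case: ifP.
by rewrite (leq_trans ti ij).
Qed.

Let C0 s : C s 0 = 0.
Proof. by rewrite /C big_pred0. Qed.

Let Cend s : C s #|S| = 1.
Proof. by rewrite -(p_sum1 s); apply: eq_bigl => t; rewrite ltn_ord. Qed.

Let cum_ge0 s t : 0 <= cum s t.
Proof. by rewrite -(C0 s); exact: C_homo. Qed.

Let cum_le1 s t : cum s t + p s t <= 1.
Proof. by rewrite -C_S -(Cend s); exact: C_homo. Qed.

Let cell (s t : S) (v : R) := cum s t <= v < cum s t + p s t.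

Let cell_ex s v : 0 <= v < 1 -> exists t, cell s t v.
Proof.
move=> /andP[v0 v1].
have ex : exists i, v < C s i by exists #|S|; rewrite Cend.
have [[|i] vi imin] := ex_minnP ex; first by rewrite C0 ltNge v0 in vi.
have iS : (i < #|S|)%N by apply: imin; rewrite Cend.
exists (enum_val (Ordinal iS)); rewrite /cell -C_S /cum enum_valK/= vi andbT.
by rewrite leNgt; apply/negP => /imin; rewrite ltnn.
Qed.

Let cell_uniq s t t' v : cell s t v -> cell s t' v -> t = t'.
Proof.
wlog tt' : t t' / (enum_rank t <= enum_rank t')%N.
  by move=> h; have [/h//|/ltnW/h h'] := leqP (enum_rank t) (enum_rank t');
    move=> ? ?; apply/esym; exact: h'.
rewrite /cell -C_S => /andP[_ h1] /andP[h2 _].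
apply/enum_rank_inj/val_inj/eqP; rewrite eqn_leq tt'/= leqNgt; apply/negP.
by move=> /(C_homo s) h; move: (lt_le_trans h1 (le_trans h h2)); rewrite ltxx.
Qed.

(* [(s, lo, len)]: the current state and the interval [lo, lo + len[ of the
   seeds u that lead to the run so far. *)
Let hit (c : S * R * R) (t : S) (u : R) :=
  let: (s, lo, len) := c in
  lo + len * cum s t <= u < lo + len * (cum s t + p s t).

Let move_to (c : S * R * R) (t : S) : S * R * R :=
  let: (s, lo, len) := c in (t, lo + len * cum s t, len * p s t).

Let inside (c : S * R * R) (u : R) := c.1.2 <= u < c.1.2 + c.2.

Let hit_inside c t u : hit c t u = inside (move_to c t) u.
Proof. by case: c => -[s lo] len; rewrite /hit /inside/= mulrDr addrA. Qed.

Let hit_cell c t u : 0 < c.2 -> hit c t u = cell c.1.1 t ((u - c.1.2) / c.2).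
Proof.
case: c => -[s lo] len /= l0; rewrite /cell ler_pdivlMr// ltr_pdivrMr//.
by rewrite lerBrDl ltrBlDl ![_ * len]mulrC.
Qed.

Let inside_gt0 c u : inside c u -> 0 < c.2.
Proof. by move=> /andP[h1 h2]; have := le_lt_trans h1 h2; rewrite ltrDl. Qed.

Let hit_ex c u : inside c u -> exists t, hit c t u.
Proof.
move=> cu; have l0 := inside_gt0 cu.
have [t ht] : exists t, cell c.1.1 t ((u - c.1.2) / c.2).
  apply: cell_ex; move/andP : cu => [h1 h2].
  by rewrite divr_ge0 ?subr_ge0 ?(ltW l0)//= ltr_pdivrMr// mul1r ltrBlDl.
by exists t; rewrite hit_cell.
Qed.

Let hit_uniq c t t' u : inside c u -> hit c t u -> hit c t' u -> t = t'.
Proof. by move=> /inside_gt0 l0; rewrite !hit_cell//; exact: cell_uniq. Qed.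

Let move_inside c t u : 0 <= c.2 -> inside (move_to c t) u -> inside c u.
Proof.
case: c => -[s lo] len /= l0 /andP[/= h1 h2]; rewrite /inside/=; apply/andP; split.
  by rewrite (le_trans _ h1)// lerDl mulr_ge0.
rewrite (lt_le_trans h2)// -addrA lerD2l -mulrDr -[leRHS]mulr1.
by rewrite ler_wpM2l.
Qed.

Variable s0 : S.

Let step u (c : S * R * R) := move_to c (odflt c.1.1 [pick t | hit c t u]).
Let conf u n := iter n (step u) (s0, 0, 1).
Let confw (w : nat -> S) := fix g n : S * R * R :=
  if n is m.+1 then move_to (g m) (w m.+1) else (s0, 0, 1).

Let conf_inside u n : 0 <= u < 1 -> inside (conf u n) u.
Proof.
move=> u01; elim: n => [|n ih]; first by rewrite /inside/= add0r.
rewrite /conf iterS -/(conf u n) /step; case: pickP => [t ht|ht]/=.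
  by rewrite -hit_inside.
by have [t] := hit_ex ih; rewrite ht.
Qed.

Let confw_len w n :
  w 0%N = s0 -> (confw w n).2 = \prod_(i < n) p (w i) (w i.+1).
Proof.
move=> w0; elim: n => [|n ih]; first by rewrite big_ord0.
rewrite big_ord_recr/= -ih.
have : (confw w n).1.1 = w n by case: n {ih} => //= m; case: (confw w m) => -[].
by case: (confw w n) => -[s lo] len /= ->.
Qed.

Let confw_ge0 w n : 0 <= (confw w n).2.
Proof.
by elim: n => //= n; case: (confw w n) => -[s lo] len /= l0; rewrite mulr_ge0.
Qed.

Let move1 c t : (move_to c t).1.1 = t.
Proof. by case: c => -[]. Qed.

Let confP u w n : 0 <= u < 1 -> w 0%N = s0 ->
  (forall i, (i <= n)%N -> (conf u i).1.1 = w i) <-> inside (confw w n) u.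
Proof.
move=> u01 w0; suff H : ((forall i, (i <= n)%N -> (conf u i).1.1 = w i) ->
    conf u n = confw w n) /\
    (inside (confw w n) u -> forall i, (i <= n)%N -> (conf u i).1.1 = w i).
  split; last by case: H.
  by move=> /(proj1 H) <-; exact: conf_inside.
elim: n => [|n [ih1 ih2]].
  by split => // _ i; rewrite leqn0 => /eqP ->.
split.
  move=> h; have e := ih1 (fun i ni => h i (leqW ni)).
  have := h n.+1 (leqnn _); rewrite /conf iterS -/(conf u n) /step move1 => h'.
  by rewrite h' e.
move=> /= hin; have hin' := move_inside (confw_ge0 w n) hin.
have hpre := ih2 hin'; have e := ih1 hpre => i.
rewrite leq_eqVlt => /predU1P[->|]; last exact: hpre.
rewrite /conf iterS -/(conf u n) /step move1 e.
case: pickP => [t ht|/(_ (w n.+1))]/=; last by rewrite hit_inside hin.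
by apply: (hit_uniq hin' ht); rewrite hit_inside.
Qed.

Let confw_itv w n : inside (confw w n) `<=` `[0, 1[%classic.
Proof.
elim: n => [|n ih] u /=; first by rewrite /inside/= add0r in_itv.
by move=> /(move_inside (confw_ge0 w n)); exact: ih.
Qed.

Let clamp (u : R) : R := if (0 <= u < 1) then u else 0.
Let sample (u : R) : run F := fun n => (conf (clamp u) n).1.1.

Let clamp01 u : 0 <= clamp u < 1.
Proof. by rewrite /clamp; case: ifPn => //; rewrite lexx ltr01. Qed.

Let sample_cyl n w : w 0%N = s0 ->
  sample @^-1` cyl n w = [set u | inside (confw w n) (clamp u)].
Proof.
by move=> w0; apply/seteqP; split => u; have := confP n (clamp01 u) w0;
  rewrite /cyl/= => h /h.
Qed.

Let sample_cyl0 n w : w 0%N <> s0 -> sample @^-1` cyl n w = set0.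
Proof.
by move=> w0; rewrite -subset0 => u /= /(_ 0 (leq0n n)) h; apply: w0; rewrite -h.
Qed.

Let inside_setE c : [set u | inside c u] = `[c.1.2, c.1.2 + c.2[%classic.
Proof. by apply/seteqP; split => u; rewrite /= in_itv. Qed.

Let measurable_clamp : measurable_fun [set: R] clamp.
Proof.
apply: measurable_fun_if => //=.
by apply: measurable_and => //; [exact: measurable_realfun.measurable_fun_ler|
  exact: measurable_realfun.measurable_fun_ltr].
Qed.

Let measurable_sample_cyl n w : measurable (sample @^-1` cyl n w).
Proof.
have [w0|w0] := pselect (w 0%N = s0); last by rewrite sample_cyl0.
rewrite sample_cyl// -[X in measurable X]setTI.
have mI : measurable [set u | inside (confw w n) u] by rewrite inside_setE.
exact: (measurable_clamp measurableT mI).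
Qed.

Let measurable_sample : measurable_fun [set: R] sample.
Proof.
apply: (@measurability _ _ R (run F) setT sample (@cylinders R F)) => //.
by move=> _ [_ [n [w ->]] <-]; rewrite setTI.
Qed.

Let unif01 := mrestr (@lebesgue_measure R) (measurable_itv `[0:R, 1[).
HB.instance Definition _ := Measure.on unif01.

Let unif01_setT : unif01 setT = 1%E.
Proof.
by rewrite /unif01 /mrestr setTI lebesgue_measure_itv/= lte_fin ltr01 oppr0 adde0.
Qed.

HB.instance Definition _ := Measure_isProbability.Build _ _ _ unif01 unif01_setT.

Let unif01_cyl n w : unif01 (sample @^-1` cyl n w) =
  ((w 0%N == s0)%:R * \prod_(i < n) p (w i) (w i.+1))%:E.
Proof.
have [w0|/eqP w0] := eqVneq (w 0%N) s0; last first.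
  by rewrite mul0r sample_cyl0// /unif01 /mrestr set0I measure0.
rewrite mul1r sample_cyl// -confw_len// /unif01 /mrestr.
have -> : [set u | inside (confw w n) (clamp u)] `&` `[0, 1[%classic =
    [set u | inside (confw w n) u].
  apply/seteqP; split => u /=; rewrite in_itv/= /clamp.
    by case=> + h; rewrite h.
  by move=> h; have := @confw_itv w n u h; rewrite /= in_itv/= => u01; rewrite u01.
rewrite inside_setE lebesgue_measure_itv/= lte_fin ltrDl.
case: ltP => h; first by rewrite -EFinD addrC addKr.
by congr EFin; apply/le_anti; rewrite confw_ge0 h.
Qed.

Lemma run_law_exists : exists mu : probability (run F) R, forall n w,
  mu (cyl n w) = ((w 0%N == s0)%:R * \prod_(i < n) p (w i) (w i.+1))%:E.
Proof.
have msample : measurable_fun [set: measurableTypeR R] sample.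
  exact: measurable_sample.
pose XM := isMeasurableFun.Build _ _ (measurableTypeR R) (run F) sample msample.
pose X : {mfun measurableTypeR R >-> run F} := HB.pack sample XM.
exists (distribution unif01 X : probability _ _) => n w; exact: unif01_cyl.
Qed.

End run_law.

Section reach_avoid.
Variables (R : realType) (F : mdp_frame R).
Implicit Types (M : mdp F) (pi : policy F) (s : state F).

Lemma chain_ge0 M pi s s' : 0 <= chain M pi s s'.
Proof.
by apply: sumr_ge0 => a aF; rewrite mulr_ge0 ?pol_ge0// trans_ge0.
Qed.

Lemma chain_sum1 M pi s : \sum_s' chain M pi s s' = 1.
Proof.
rewrite /chain exchange_big/= -(pol_sum1 pi s) [RHS](bigID (mem (avail F s)))/=.
rewrite [X in _ + X]big1 ?addr0; last by move=> a; exact: pol_avail.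
by apply: eq_bigr => a aF; rewrite -mulr_sumr trans_sum1// mulr1.
Qed.

(* The law of the state sequence when following [pi] in [M] from [s]; by
   [run_measure_unique] below it is determined by its values on cylinders. *)
Definition run_measure M pi s : probability (run F) R :=
  projT1 (cid (run_law_exists (@chain_ge0 M pi) (@chain_sum1 M pi) s)).

Lemma run_measureE M pi s n w : run_measure M pi s (cyl n w) =
  ((w 0%N == s)%:R * \prod_(i < n) chain M pi (w i) (w i.+1))%:E.
Proof. by rewrite /run_measure; case: cid. Qed.

Lemma run_measure_unique M pi s (mu : probability (run F) R) :
  (forall n w, mu (cyl n w) =
    ((w 0%N == s)%:R * \prod_(i < n) chain M pi (w i) (w i.+1))%:E) ->
  forall A, measurable A -> mu A = run_measure M pi s A.
Proof.
move=> muE A mA; pose G : set (set (run F)) :=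
  [set C | [\/ C = setT, C = set0 | cylinders C]].
have mG : G `<=` measurable.
  by move=> C [->|->|?] //; exact: sub_sigma_algebra.
apply: (@g_sigma_algebra_measure_unique _ R (run F) G mG (fun=> setT)) => //.
- by move=> _; constructor.
- by apply/seteqP; split => // x _; exists 0%N.
- move=> C D [->|->|GC]; rewrite ?setTI ?set0I//; first by move=> _; constructor 2.
  case=> [->|->|GD]; rewrite ?setIT ?setI0; [by constructor 3|by constructor 2|].
  case: GC GD => n [w ->] [m [v ->]].
  wlog nm : n m v w / (n <= m)%N.
    by move=> h; have [/h//|/ltnW/h] := leqP n m; rewrite setIC.
  have [e|ne] := pselect (forall i, (i <= n)%N -> v i = w i).
    constructor 3; exists m, v; apply/seteqP; split => [x []//|x xv].
    by split => // i ni; rewrite xv ?e// (leq_trans ni).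
  constructor 2; rewrite -subset0 => x [xw xv]; apply: ne => i ni.
  by rewrite -xw// xv// (leq_trans ni).
- move=> C [->|->|[n [w ->]]]; last 1 first.
  + exact: etrans (muE n w) (esym (run_measureE M pi s n w)).
  + exact: etrans (probability_setT mu) (esym (probability_setT _)).
  + exact: etrans (measure0 mu) (esym (measure0 _)).
- move=> _; have muT : mu [set: run F] = 1%E by exact: probability_setT.
  by apply: (@eq_ind_r _ 1%E (fun z => z < +oo)%E _ _ muT); rewrite ltry.
- apply: (@sub_smallest2r _ _ (@cylinders R F)) => // C GC.
  by constructor 3.
Qed.

Definition reach_avoid (S_T S_U : {set state F}) : set (run F) :=
  [set x | exists n, x n \in S_T /\ forall m, (m < n)%N -> x m \notin S_U].

Lemma measurable_reach_avoid (S_T S_U : {set state F}) :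
  measurable (reach_avoid S_T S_U).
Proof.
pose st n (B : {set state F}) : set (run F) := [set x | x n \in B].
have mst n B : measurable (st n B).
  have -> : st n B = \bigcup_(w in [set w : n.+1.-tuple (state F) |
      tnth w ord_max \in B]) cyl n (nth (init F) w).
    apply/seteqP; split => [x xB|x [w /= wB xw]].
      exists [tuple x i | i < n.+1]; first by rewrite /= tnth_mktuple.
      by move=> i ni; rewrite -[i]/(val (Ordinal (ni : (i < n.+1)%N)))
        -tnth_nth tnth_mktuple.
    by rewrite /st/= xw// -[n in nth _ _ n]/(val (@ord_max n)) -tnth_nth.
  apply: fin_bigcup_measurable => // w _.
  by apply: sub_sigma_algebra; exists n, (nth (init F) w).
have -> : reach_avoid S_T S_U =
    \bigcup_n (st n S_T `&` \bigcap_(m < n) ~` st m S_U).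
  apply/seteqP; split => x; case=> n.
    by case=> xT xU; exists n => //; split => // m /= /xU/negP.
  by move=> _ [xT xU]; exists n; split => // m /xU /negP.
apply: bigcupT_measurable => n; apply: measurableI => //.
by apply: fin_bigcap_measurable => // m _; exact: measurableC.
Qed.

Definition reach_avoid_prob (S_T S_U : {set state F}) M pi s : \bar R :=
  run_measure M pi s (reach_avoid S_T S_U).

(* max and min are rendered by sup and inf in \bar R. An inconsistent interval
   MDP, to which no MDP belongs, has robust value +oo (inf of the empty set). *)
Definition opt_value (S_T S_U : {set state F}) M s : \bar R :=
  ereal_sup [set reach_avoid_prob S_T S_U M pi s | pi in [set: policy F]].

Definition robust_value (S_T S_U : {set state F}) (I : imdp F) s : \bar R :=
  ereal_sup [set ereal_inf [set reach_avoid_prob S_T S_U M pi s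
                           | M in [set M | in_imdp M I]]
            | pi in [set: policy F]].

End reach_avoid.

(* Main.v *)
Require Import Defs.
From HB Require Import structures.
From mathcomp Require Import all_boot all_order all_algebra.
From mathcomp Require Import all_classical all_reals all_analysis.

Set Implicit Arguments.
Unset Strict Implicit.
Unset Printing Implicit Defensive.

Import Order.TTheory GRing.Theory Num.Theory.
Local Open Scope classical_set_scope.
Local Open Scope ring_scope.

(** For a fixed policy, the infimum over the members of [I] is at most the probability in the member
    [M], and suprema over policies preserve this. No randomness enters: the bound is used for each
    dataset separately. *)
Lemma robust_value_le_opt_value (R : realType) (F : mdp_frame R)
    (S_T S_U : {set state F}) (M : mdp F) (I : imdp F) (s : state F) :
  in_imdp M I -> (robust_value S_T S_U I s <= opt_value S_T S_U M s)%E.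
Proof.
move=> MI; apply: ge_ereal_sup => _ [pi _ <-].
apply: (@le_trans _ _ (reach_avoid_prob S_T S_U M pi s)).
  by apply: ereal_inf_lbound; exists M.
by apply: ereal_sup_ubound; exists pi.
Qed.

(* The law Pr of the random dataset lives on the measurable space DS of
   datasets; Mhat maps a dataset to the interval MDP estimated from it. The two
   measurability hypotheses say that the sets whose probability is taken are
   events. *)
Theorem lemma1 (R : realType) (F : mdp_frame R) (S_T S_U : {set state F})
  (disj_TU : S_T :&: S_U = finset.set0)
  (Mstar : mdp F)
  (d : measure_display) (DS : measurableType d) (Pr : probability DS R)
  (Mhat : DS -> imdp F) (delta : R) (delta01 : 0 <= delta <= 1)
  (mem_event : measurable [set D | in_imdp Mstar (Mhat D)])
  (mem_prob : ((1 - delta)%:E <= Pr [set D | in_imdp Mstar (Mhat D)])%E)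
  (s : state F)
  (value_event : measurable
     [set D | (robust_value S_T S_U (Mhat D) s <= opt_value S_T S_U Mstar s)%E]) :
  ((1 - delta)%:E <=
     Pr [set D | (robust_value S_T S_U (Mhat D) s <= opt_value S_T S_U Mstar s)%E])%E.
Proof.
(* Monotonicity of [Pr]: the membership event is contained in the value event, both being measurable
   by hypothesis. *)
apply: (le_trans mem_prob); apply: le_measure; rewrite ?inE// => D /=.
exact: robust_value_le_opt_value.
Qed.
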